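(* Let $\sigma \in \mathcal{C}_q$ with $\operatorname{des}(\sigma)=d$, $\operatorname{sym}(\sigma)=s$ and $\mathbf{sig}(\sigma)=(a_1,\ldots,a_q)$. Then, for every integer $k \geq \max\{d,2\}$ the number of realizations of $\sigma$ under $\mathbf{m}_k$ is $$\binom{q+k-d+a_q-1}{q},$$ while the number of realizations of the combinatorial type $[\sigma]$ under $\mathbf{m}_k$ is $$\frac{k-1}{s}\binom{q+k-d-1}{q-1}.$$
   Context: Fix an integer $q\ge 2$. $\mathcal{S}_q$ is the group of permutations of $\mathbb{Z}/q\mathbb{Z}$, whose elements are identified with their representatives in $\{1,\dots,q\}$ (indices are taken modulo $q$). $\mathcal{C}_q\subset\mathcal{S}_q$ is the set of $q$-cycles. $\rho\in\mathcal{C}_q$ is $\rho(i)=i+1 \pmod q$, and $\mathcal{R}_q=\langle\rho\rangle$ is the rotation group, acting on $\mathcal{C}_q$ by conjugation. The combinatorial type $[\sigma]$ of $\sigma$ is its orbit $\{\rho^j\sigma\rho^{-j}: j\in\mathbb{Z}\}$ under this action; the symmetry order $\operatorname{sym}(\sigma)$ is the order of the stabilizer $\{\rho^i:\rho^i\sigma\rho^{-i}=\sigma\}$. Descent number: $\operatorname{des}(\sigma)=\#\{i\in\mathbb{Z}/q\mathbb{Z}:\sigma(i)>\sigma(i+1)\}$, where the inequality uses the linear order of the representatives $1,\dots,q$ and $i=q$ is included (comparing $\sigma(q)$ with $\sigma(1)$). For $a\ne b$ in $\mathbb{Z}/q\mathbb{Z}$, $[a,b)$ denotes the cyclic interval $\{a,a+1,\dots,b-1\}$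 (mod $q$). The signature of $\sigma\in\mathcal{C}_q$ is $\mathbf{sig}(\sigma)=(a_1,\dots,a_q)$ where $a_i=1$ if $i\in[\sigma(i),\sigma(i+1))$ and $a_i=0$ otherwise. For an integer $k\ge2$, $\mathbf{m}_k:\mathbb{R}/\mathbb{Z}\to\mathbb{R}/\mathbb{Z}$ is $\mathbf{m}_k(x)=kx \pmod{\mathbb{Z}}$. A period $q$ orbit is $\mathcal{O}=\{x_1,\dots,x_q\}$, with $q$ distinct points labeled (by representatives in $[0,1)$) so that $0<x_1<\dots<x_q<1$. $\mathcal{O}$ is a realization of $\sigma\in\mathcal{C}_q$ under $\mathbf{m}_k$ if $\mathbf{m}_k(x_i)=x_{\sigma(i)}$ for all $i$; it is a realization of the combinatorial type $[\sigma]$ if it is a realization of some element of $[\sigma]$. The number of realizations is the number of such orbits. Convention: $\binom{m}{q}=0$ for integers $0\le m<q$. *)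

(* Defs.v *)
From HB Require Import structures.
From mathcomp Require Export all_boot all_order all_algebra all_fingroup.
From mathcomp Require Export generic_quotient.
From mathcomp Require Export boolp classical_sets functions cardinality reals.

Set Implicit Arguments.
Unset Strict Implicit.
Unset Printing Implicit Defensive.

Import GRing.Theory Num.Theory.

(* Z/qZ is 'I_q, with the element whose representative in {1, ..., q} is j    *)
(* encoded as the ordinal j - 1; the order of representatives and cyclic      *)
(* differences are unchanged, and i + 1 mod q is ordS i.                      *)

Definition is_qcycle (q : nat) (s : 'S_q) : bool :=
  porbits s == [set [set: 'I_q]]%SET.

Definition rho (q : nat) : 'S_q := perm (@ordS_inj q).

(* s ^ r = r^-1 * s * r in {perm _}, where products compose left to right:    *)
(* as functions this is r \o s \o r^-1.                                       *)
Definition comb_type (q : nat) (s : 'S_q) : {set 'S_q} :=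
  orbit 'J%act <[rho q]>%g s.

Definition symord (q : nat) (s : 'S_q) : nat :=
  #|('C_(<[rho q]>)[s | 'J])%g|.

Definition des (q : nat) (s : 'S_q) : nat :=
  #|[set i : 'I_q | (s (ordS i) < s i)%N]|.

(* {a, a + 1, ..., b - 1} mod q for a != b (empty for a = b)                  *)
Definition cyc_itv (q : nat) (a b : 'I_q) : {set 'I_q} :=
  [set j : 'I_q | ((j + q - a) %% q < (b + q - a) %% q)%N].

Definition sig (q : nat) (s : 'S_q) : q.-tuple nat :=
  [tuple nat_of_bool (i \in cyc_itv (s i) (s (ordS i))) | i < q].

Local Open Scope ring_scope.
Local Open Scope quotient_scope.

Definition eqmodZ (R : realType) : rel R := fun x y => x - y \is a Num.int.

Lemma eqmodZ_refl (R : realType) : reflexive (@eqmodZ R).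
Proof. by move=> x; rewrite /eqmodZ subrr rpred0. Qed.

Lemma eqmodZ_sym (R : realType) : symmetric (@eqmodZ R).
Proof. by move=> x y; rewrite /eqmodZ rpredBC. Qed.

Lemma eqmodZ_trans (R : realType) : transitive (@eqmodZ R).
Proof. by move=> y x z xy yz; rewrite /eqmodZ -(subrKA y) rpredD. Qed.

Canonical eqmodZ_equiv (R : realType) :=
  EquivRel (@eqmodZ R) (@eqmodZ_refl R) (@eqmodZ_sym R) (@eqmodZ_trans R).

(* R/Z *)
Definition circle (R : realType) : Type := {eq_quot (@eqmodZ R)}.

HB.instance Definition _ (R : realType) := Choice.on (circle R).
HB.instance Definition _ (R : realType) := EqQuotient.on (circle R).

Definition circle_pi (R : realType) (x : R) : circle R := \pi_(circle R) x.

Lemma circle_piP (R : realType) (x y : R) :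
  circle_pi x = circle_pi y <-> x - y \is a Num.int.
Proof.
split=> [/eqP|xy]; first by rewrite /circle_pi piE.
by apply/eqP; rewrite /circle_pi piE.
Qed.

Definition mulcirc (R : realType) (k : nat) (t : circle R) : circle R :=
  circle_pi (k%:R * repr t).

Lemma mulcircE (R : realType) (k : nat) (x : R) :
  mulcirc k (circle_pi x) = circle_pi (k%:R * x).
Proof.
apply/circle_piP; rewrite -mulrBr rpredM ?rpred_nat//.
by apply/circle_piP; rewrite /circle_pi reprK.
Qed.

Definition period_orbit (T : eqType) (f : T -> T) (q : nat) (O : set T) : Prop :=
  exists x : T,
    [/\ iter q f x = x, uniq (traject f x q) & O = [set` traject f x q]%classic].

Definition realizes (R : realType) (k q : nat) (s : 'S_q)
    (O : set (circle R)) : Prop :=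
  period_orbit (mulcirc k) q O /\
  exists x : 'I_q -> R,
    [/\ forall i, 0 < x i < 1,
        forall i j : 'I_q, (i < j)%N -> x i < x j,
        O = range (fun i => circle_pi (x i)) &
        forall i, mulcirc k (circle_pi (x i)) = circle_pi (x (s i))].

Definition realizes_type (R : realType) (k q : nat) (s : 'S_q)
    (O : set (circle R)) : Prop :=
  exists2 t : 'S_q, t \in comb_type s & realizes k t O.

(* Main.v *)
Require Import Defs.
From mathcomp Require Import zify ring lra.

Set Implicit Arguments.
Unset Strict Implicit.
Unset Printing Implicit Defensive.

Import Order.TTheory GRing.Theory Num.Theory.

(** Let $x_1 < \dots < x_q$ be a realization of $\sigma$ and write
    $k x_i = x_{\sigma(i)} + n_i$ with $n_i$ an integer. Since all $x_i$ lie in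
    $(0, 1)$, the digit $n_i$ lies in $\{0, \dots, k-1\}$, and
    $k(x_j - x_i) = (x_{\sigma(j)} - x_{\sigma(i)}) + (n_j - n_i)$ forces, for
    $i < j$, that $n_i \le n_j$, with $n_i < n_j$ if $\sigma(i) > \sigma(j)$.
    Digits with this property are called admissible. Conversely, since $\sigma$
    has order $q$, the system $k x_i = x_{\sigma(i)} + n_i$ has exactly one
    solution for given digits. If the digits are admissible, an inversion
    $i < j$, $x_i \ge x_j$ of this solution would propagate along the cycle to
    $\sigma(i) < \sigma(j)$, $x_{\sigma(i)} \ge x_{\sigma(j)}$; but a cycle
    cannot preserve the order of a pair for ever ([one_cycle_inversion]). So
    realizations of $\sigma$ correspond to admissible digits
    ([realizes_coded], [coded_of_realizes], [coded_inj]), and the orbit also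
    determines $\sigma$, so that realizations of distinct elements of
    $[\sigma]$ are never counted twice ([card_realizations]).

    Adding to $n_i$ the number of ascents $\sigma(j) < \sigma(j+1)$, $j < i$,
    turns admissible digits into strictly increasing sequences with values
    below $k$ plus the number of ascents at positions before $q$; these are counted by a
    binomial coefficient. The cyclic descent number counts the position $q$ as
    well, and $a_q$ tells whether it is a descent ([ascents_des]); hence the
    first formula ([card_admissible]).

    For the second formula, put $g_i = \sigma(i+1) - \sigma(i)$ and
    $l_i = i - \sigma(i)$, reduced to $\{0, \dots, q-1\}$. Conjugation by a
    rotation only shifts the indices of these two sequences. As $\sigma(i)$
    runs once through $\mathbb{Z}/q\mathbb{Z}$ the steps $g_i$ wind
    $\mathrm{des}(\sigma)$ times around, so $\sum_i g_i = q\,\mathrm{des}(\sigma)$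
    ([sum_gap]), and the descent number is constant on $[\sigma]$. Moreover
    $a_i = 1$ exactly when $l_i < g_i$, so that
    $l_{i+1} = l_i + 1 - g_i + q a_i$; summing over $i$ gives
    $\sum_i a_i = \mathrm{des}(\sigma) - 1$ ([sum_sig]). The last signature
    entries of the $q$ rotated copies of $\sigma$ are $a_1, \dots, a_q$ in some
    order, and each element of $[\sigma]$ occurs $s$ times among these copies
    ([sum_orbit]); so $s$ times the number of realizations of $[\sigma]$ is
    $(d-1)\binom{M+1}{q} + (q-d+1)\binom{M}{q} = (k-1)\binom{M}{q-1}$ with
    $M = q+k-d-1$ ([binomial_sum], [sum_comb_type]). *)

(** * Admissible digits *)

(** Relating all pairs, and not only neighbours, makes the relation transitive,
    so that it can be tested on consecutive indices. *)
Definition digit_step (q k : nat) (t : 'S_q) (n : {ffun 'I_q -> 'I_k}) : rel 'I_q :=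
  fun i j => (n i + (t j < t i)%N <= n j)%N.

Definition admissible (q k : nat) (t : 'S_q) : {set {ffun 'I_q -> 'I_k}} :=
  [set n | sorted (digit_step t n) (enum 'I_q)]%SET.

Lemma digit_step_trans (q k : nat) (t : 'S_q) (n : {ffun 'I_q -> 'I_k}) :
  transitive (digit_step t n).
Proof. by move=> j i l; rewrite /digit_step; case: ltnP; case: ltnP; case: ltnP; lia. Qed.

Lemma nth_enum_ordK (q : nat) (x0 i : 'I_q) : nth x0 (enum 'I_q) i = i.
Proof. by apply: val_inj; rewrite /= nth_enum_ord. Qed.

Lemma pairwise_enum_ordP (q : nat) (r : rel 'I_q) :
  reflect (forall i j : 'I_q, (i < j)%N -> r i j) (pairwise r (enum 'I_q)).
Proof.
case: q r => [|q] r.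
  by apply: (iffP idP) => [_ []//|_]; rewrite (size0nil (size_enum_ord 0)).
apply: (iffP (pairwiseP ord0)) => rP i j.
  move=> ij; have := rP i j; rewrite !inE size_enum_ord !ltn_ord.
  by rewrite !nth_enum_ordK; apply.
rewrite !inE size_enum_ord => iq jq ij.
by rewrite (nth_enum_ordK _ (Ordinal iq)) (nth_enum_ordK _ (Ordinal jq)) rP.
Qed.

Lemma sorted_enum_ordP (q : nat) (r : rel 'I_q) :
  reflect (forall i : 'I_q, (i.+1 < q)%N -> r i (ordS i)) (sorted r (enum 'I_q)).
Proof.
case: q r => [|q] r.
  by apply: (iffP idP) => [_ []//|_]; rewrite (size0nil (size_enum_ord 0)).
apply: (iffP (sortedP ord0)) => rP i; rewrite ?size_enum_ord => iq.
  have := rP i; rewrite size_enum_ord nth_enum_ordK => /(_ iq).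
  suff -> : nth ord0 (enum 'I_q.+1) i.+1 = ordS i by [].
  by apply: val_inj; rewrite /= nth_enum_ord// modn_small.
have iq' := ltnW iq; have := rP (Ordinal iq') iq.
suff [-> ->] : nth ord0 (enum 'I_q.+1) i = Ordinal iq' /\
  nth ord0 (enum 'I_q.+1) i.+1 = ordS (Ordinal iq') by [].
by split; apply: val_inj; rewrite /= nth_enum_ord// modn_small.
Qed.

Lemma admissibleP (q k : nat) (t : 'S_q) (n : {ffun 'I_q -> 'I_k}) :
  reflect (forall i j : 'I_q, (i < j)%N -> (n i + (t j < t i)%N <= n j)%N)
          (n \in admissible k t).
Proof.
by rewrite inE sorted_pairwise; [exact: pairwise_enum_ordP|exact: digit_step_trans].
Qed.

Definition ascents (q : nat) (t : 'S_q) (m : nat) : nat :=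
  #|[set j : 'I_q | (j < m)%N && (t j < t (ordS j))%N]%SET|.

Lemma ascents_le (q : nat) (t : 'S_q) : {homo ascents t : m n / (m <= n)%N}.
Proof.
move=> m n mn; apply/subset_leq_card/fintype.subsetP => j; rewrite !inE.
by move=> /andP[/leq_trans/(_ mn)-> ->].
Qed.

Lemma ascentsS (q : nat) (t : 'S_q) (i : 'I_q) :
  ascents t i.+1 = (ascents t i + (t i < t (ordS i)))%N.
Proof.
rewrite /ascents (cardsD1 i) inE ltnSn /= addnC; congr (_ + _)%N.
by apply: eq_card => j; rewrite !inE ltnS [in RHS]ltn_neqAle andbA.
Qed.

(** The position [q.-1] is the only one that [ascents t q.-1] does not see. It
    is a descent exactly when the cyclic interval from [t ord_max] to [t 0]
    wraps around and so contains [ord_max]. *)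
Lemma ascents_des (q : nat) (t : 'S_q) (a := nth 0%N (sig t) q.-1) : (2 <= q)%N ->
  (ascents t q.-1 + des t + 1 = q + a)%N.
Proof.
case: q t @a => [//|p] t a p1.
have tS (i : 'I_p.+1) : t i != t (ordS i) :> nat.
  apply/eqP => /val_inj/perm_inj/(congr1 val)/=.
  move: (ltn_ord i); rewrite ltnS leq_eqVlt => /orP[/eqP->|ip].
    by rewrite modnn; lia.
  by rewrite modn_small; lia.
have aE : a = (t (ordS ord_max) < t ord_max)%N.
  rewrite /a /sig (nth_mktuple _ _ (ord_max : 'I_p.+1)) inE; congr nat_of_bool.
  have := tS ord_max; move: (ltn_ord (t ord_max)) (ltn_ord (t (ordS ord_max))).
  move: (nat_of_ord (t (ordS ord_max))) (nat_of_ord (t ord_max)) => u v.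
  rewrite [nat_of_ord ord_max]/= => vp up uv.
  rewrite (_ : p + p.+1 - v = p - v + p.+1)%N; last by lia.
  rewrite modnDr modn_small; last by lia.
  case: (ltnP u v) => uv'; first by rewrite modn_small; lia.
  rewrite (_ : u + p.+1 - v = u - v + p.+1)%N; last by lia.
  by rewrite modnDr modn_small; lia.
have tot : (ascents t p.+1 + des t = p.+1)%N.
  rewrite -[RHS]card_ord -(cardsC [set i : 'I_p.+1 | (t (ordS i) < t i)%N]%SET) addnC.
  congr (_ + _)%N; apply: eq_card => i; rewrite !inE ltn_ord /=.
  by have := tS i; lia.
have := ascentsS t ord_max; have := tS ord_max; move: tot; rewrite aE /=.
case: ltnP; case: ltnP; lia.
Qed.

(** A weak increase is allowed exactly at the ascents; adding the number of
    earlier ascents makes every increase strict. *)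
Lemma admissible_lift (q k : nat) (t : 'S_q) (n : {ffun 'I_q -> 'I_k}) :
  (n \in admissible k t) = sorted (fun i j => n i + ascents t i < n j + ascents t j)%N (enum 'I_q).
Proof.
rewrite inE; apply/sorted_enum_ordP/sorted_enum_ordP => nP i iq; have := nP i iq;
 rewrite /digit_step /= modn_small// ascentsS; have : t i != t (ordS i) :> nat.
1,3: by apply/eqP => /val_inj/perm_inj/(congr1 val)/=; rewrite modn_small//; lia.
all: by case: ltnP; case: ltnP; lia.
Qed.

(** The lifted digits are the strictly increasing sequences below
    [k + ascents t q.-1]. Conversely such a sequence grows at least as fast as
    [ascents t], so the number of ascents can be subtracted again. *)
Lemma card_admissible (q k : nat) (t : 'S_q) (a := nth 0%N (sig t) q.-1) :
  (2 <= q)%N -> #|admissible k t| = 'C(q + k - des t + a - 1, q).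
Proof.
move=> q2.
have -> : (q + k - des t + a - 1 = k + ascents t q.-1)%N.
  have := max_card [set i : 'I_q | (t (ordS i) < t i)%N]%SET.
  by have := ascents_des t q2; rewrite -/a card_ord -/(des t); lia.
set N := (k + _)%N; rewrite -card_ltn_sorted_tuples.
have ltN (n : {ffun 'I_q -> 'I_k}) (i : 'I_q) : (n i + ascents t i < N)%N.
  by rewrite -addSn leq_add// ascents_le//; have := ltn_ord i; lia.
pose f n := mktuple (fun i => Ordinal (ltN n i)).
have f_inj : injective f.
  move=> n n' /(congr1 (fun u => tnth u)) nn'; apply/ffunP => i; apply: val_inj.
  have := congr1 (fun u => nat_of_ord (u i)) nn'.
  by rewrite !tnth_mktuple /=; lia.
rewrite -(card_imset _ f_inj); apply: eq_card => u; rewrite inE.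
have srt (v : q.-tuple 'I_N) : sorted ltn [seq \val i | i <- v] =
    sorted (fun i j => tnth v i < tnth v j)%N (enum 'I_q).
  by rewrite {1}(tuple_map_ord v) -map_comp sorted_map.
apply/imsetP/idP => [[n nA ->]|].
  rewrite srt; move: nA; rewrite admissible_lift.
  by apply: sub_sorted => i j; rewrite !tnth_mktuple.
rewrite srt => uS.
(* [tnth u i - ascents t i] does not decrease, written without subtraction. *)
have : sorted (fun i j => tnth u i + ascents t j <= tnth u j + ascents t i)%N (enum 'I_q).
  apply/sorted_enum_ordP => i iq; move/sorted_enum_ordP: uS => /(_ _ iq).
  by rewrite /= [in ascents t (_ %% _)]modn_small// ascentsS; lia.
rewrite sorted_pairwise; last by move=> j i l; lia.
move=> /pairwise_enum_ordP uP.
have {}uP (i j : 'I_q) : (i <= j)%N -> (tnth u i + ascents t j <= tnth u j + ascents t i)%N.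
  by rewrite leq_eqVlt => /orP[/eqP/val_inj->|/uP//]; lia.
have q0 : (0 < q)%N by lia.
have q1 : (q.-1 < q)%N by lia.
have asc0 : ascents t 0 = 0%N by apply: eq_card0 => i; rewrite inE.
have lo (i : 'I_q) : (ascents t i <= tnth u i)%N.
  by have := uP (Ordinal q0) i isT; rewrite /= asc0; lia.
have hi (i : 'I_q) : (tnth u i - ascents t i < k)%N.
  have iq : (i <= q.-1)%N by have := ltn_ord i; lia.
  have hq : (tnth u (Ordinal q1) < k + ascents t q.-1)%N by exact: ltn_ord.
  move: (uP i (Ordinal q1) iq) hq (lo i).
  by move: (tnth u (Ordinal q1) : nat) (tnth u i : nat) => v w /=; lia.
exists [ffun i => Ordinal (hi i)].
  rewrite admissible_lift; move: uS; apply: sub_sorted => i j.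
  by rewrite !ffunE /= !subnK.
by apply: eq_from_tnth => i; apply: val_inj; rewrite tnth_mktuple /= ffunE /= subnK.
Qed.

(** * Permutations with a single cycle *)

Local Open Scope ring_scope.

(** Unlike [is_qcycle], this form is used pointwise: any index is reached from
    any other. *)
Definition one_cycle (q : nat) (t : 'S_q) : Prop := forall i j, j \in porbit t i.

Lemma qcycle_one_cycle (q : nat) (t : 'S_q) : is_qcycle t -> one_cycle t.
Proof.
move=> /eqP tq i j; have : porbit t i \in porbits t by apply/imsetP; exists i.
by rewrite tq inE => /eqP->; rewrite inE.
Qed.

Lemma one_cycle_card (q : nat) (t : 'S_q) (i : 'I_q) :
  one_cycle t -> #|porbit t i| = q.
Proof. by move=> tc; rewrite -[RHS]card_ord; apply: eq_card => j; rewrite tc. Qed.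

Lemma one_cycle_expn (q : nat) (t : 'S_q) : one_cycle t -> (t ^+ q = 1)%g.
Proof.
move=> tc; apply/permP => i.
by rewrite perm1 permX -[X in iter X](one_cycle_card i tc) iter_porbit.
Qed.

Lemma one_cycle_reach (q : nat) (t : 'S_q) (i j : 'I_q) :
  one_cycle t -> exists m : 'I_q, j = (t ^+ m)%g i.
Proof.
move=> tc; have := tc i j; rewrite porbit_traject one_cycle_card//.
by case/trajectP => m mq ->; exists (Ordinal mq); rewrite permX.
Qed.

(** * Descents and signatures under rotation *)

Lemma ordSE (p : nat) (i : 'I_p.+2) : ordS i = i + 1.
Proof. by apply: val_inj; rewrite /= modnDmr addn1. Qed.

Lemma val_ordB (p : nat) (a b : 'I_p.+2) : nat_of_ord (a - b) = ((a + p.+2 - b) %% p.+2)%N.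
Proof. by rewrite /= modnDmr addnBA// ltnW. Qed.

Lemma val_ordD (p : nat) (a b : 'I_p.+2) :
  (nat_of_ord (a + b)%R + (p.+2 <= a + b) * p.+2 = a + b)%N.
Proof.
rewrite /=; case: leqP => [ab|ab]; first by rewrite modn_small// mul0n addn0.
have -> : (a + b = a + b - p.+2 + p.+2)%N by lia.
rewrite modnDr modn_small ?mul1n//; move: (ltn_ord a) (ltn_ord b); lia.
Qed.

(** Here and below ['I_p.+2] carries its ring structure of integers modulo
    [p.+2], while sums in [nat] use the representatives. *)
Definition gap (p : nat) (t : 'S_p.+2) (i : 'I_p.+2) : 'I_p.+2 := t (i + 1) - t i.

Definition lag (p : nat) (t : 'S_p.+2) (i : 'I_p.+2) : 'I_p.+2 := i - t i.

Lemma nth_sig (p : nat) (t : 'S_p.+2) (i : 'I_p.+2) :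
  nth 0%N (sig t) i = (lag t i < gap t i)%N.
Proof. by rewrite nth_mktuple inE -!val_ordB ordSE. Qed.

Lemma desE (p : nat) (t : 'S_p.+2) : des t = (\sum_i (t (i + 1)%R < t i))%N.
Proof.
rewrite /des -sum1_card big_mkcond; apply: eq_bigr => i _.
by rewrite inE ordSE; case: ltnP.
Qed.

(** Each step from [t i] to [t (i + 1)] increases the representative by
    [gap t i], minus [p.+2] at a descent; the increments of a closed walk cancel. *)
Lemma sum_gap (p : nat) (t : 'S_p.+2) : (\sum_i gap t i = p.+2 * des t)%N.
Proof.
have sumS : (\sum_i t (i + 1)%R = \sum_i t i)%N.
  by rewrite [RHS](reindex_inj (addIr 1)).
apply: (@addnI (\sum_i t i)%N); rewrite -[in RHS]sumS desE big_distrr -!big_split.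
apply: eq_bigr => i _; rewrite -[LHS]/(t i + gap t i)%N.
rewrite -[RHS]/(t (i + 1)%R + p.+2 * (t (i + 1)%R < t i))%N.
have := val_ordD (t i) (gap t i).
rewrite (_ : t i + gap t i = t (i + 1)); last by rewrite addrC subrK.
move: (ltn_ord (t (i + 1))) (ltn_ord (t i)) (ltn_ord (gap t i)).
move: (nat_of_ord (t (i + 1))) (nat_of_ord (t i)) (nat_of_ord (gap t i)) => u v g.
by move=> up vp gp; case: leqP; case: ltnP; lia.
Qed.

Lemma one_cycle_lag (p : nat) (t : 'S_p.+2) (i : 'I_p.+2) :
  one_cycle t -> (0 < lag t i)%N.
Proof.
move=> tc; rewrite lt0n; apply/eqP => l0.
have ti : t i = i.
  by apply/esym/eqP; rewrite -subr_eq0; apply/eqP/val_inj.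
have [m /eqP] := one_cycle_reach i (i + 1) tc.
rewrite permX iter_fix// -subr_eq0 addrAC subrr add0r.
by rewrite oner_eq0.
Qed.

(** Modulo [p.+2], [lag t (i + 1) + gap t i] is [lag t i + 1]. As no lag is zero,
    the two sides are equal unless [lag t i < gap t i], when they differ by
    exactly [p.+2]; the lags cancel in the sum over [i]. *)
Lemma sum_sig (p : nat) (t : 'S_p.+2) : one_cycle t ->
  ((\sum_(i < p.+2) nth 0 (sig t) i).+1 = des t)%N.
Proof.
move=> tc.
have lagS : (\sum_i lag t (i + 1)%R = \sum_i lag t i)%N.
  by rewrite [RHS](reindex_inj (addIr 1)).
have stepE i : (lag t i + (1 + p.+2 * nth 0 (sig t) i) = lag t (i + 1)%R + gap t i)%N.
  rewrite nth_sig; have := val_ordD (lag t (i + 1)) (gap t i).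
  have := val_ordD (lag t i) 1.
  have -> : lag t (i + 1) + gap t i = lag t i + 1.
    by rewrite /lag /gap addrA subrK addrAC.
  move: (one_cycle_lag i tc) (one_cycle_lag (i + 1) tc).
  rewrite (_ : nat_of_ord (1 : 'I_p.+2) = 1%N)//.
  move: (ltn_ord (lag t (i + 1))) (ltn_ord (lag t i)) (ltn_ord (gap t i)).
  move: (nat_of_ord (lag t (i + 1))) (nat_of_ord (lag t i)) (nat_of_ord (gap t i)) => u v g.
  by move=> up vp gp u0 v0; case: ltnP => ?; do 2 case: leqP => ?; lia.
have : (\sum_i lag t i + \sum_(i < p.+2) (1 + p.+2 * nth 0 (sig t) i)
    = \sum_i lag t (i + 1)%R + \sum_i gap t i)%N.
  by rewrite -!big_split; apply: eq_bigr => i _; apply: stepE.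
rewrite lagS => /addnI; rewrite sum_gap => gapE.
apply/eqP; rewrite -(@eqn_pmul2l p.+2)// -gapE; apply/eqP.
by rewrite big_split -big_distrr sum1_card card_ord mulnS.
Qed.

Lemma rhoX (p m : nat) (i : 'I_p.+2) : (rho p.+2 ^+ m)%g i = i + m%:R.
Proof.
rewrite permX; elim: m => [|m IH]; first by rewrite addr0.
by rewrite iterS IH permE ordSE -addrA -natr1.
Qed.

Lemma gap_conj (p m : nat) (t : 'S_p.+2) (i : 'I_p.+2) :
  gap (t ^ (rho p.+2 ^+ m))%g (i + m%:R) = gap t i.
Proof.
rewrite /gap addrAC -!rhoX !permJ !rhoX opprD addrACA.
by rewrite subrr addr0.
Qed.

Lemma lag_conj (p m : nat) (t : 'S_p.+2) (i : 'I_p.+2) :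
  lag (t ^ (rho p.+2 ^+ m))%g (i + m%:R) = lag t i.
Proof. by rewrite /lag -!rhoX !permJ !rhoX opprD addrACA subrr addr0. Qed.

(** The formula of [sum_gap] is visibly invariant, although the set of descents
    is not. *)
Lemma des_conj (p m : nat) (t : 'S_p.+2) : des (t ^ (rho p.+2 ^+ m))%g = des t.
Proof.
apply/eqP; rewrite -(@eqn_pmul2l p.+2)// -!sum_gap; apply/eqP.
rewrite (reindex_inj (addIr m%:R)); apply: eq_bigr => i _.
by rewrite gap_conj.
Qed.

Lemma one_cycle_conj (q : nat) (t r : 'S_q) : one_cycle t -> one_cycle (t ^ r)%g.
Proof.
move=> tc i j; have [m jE] := one_cycle_reach ((r^-1)%g i) ((r^-1)%g j) tc.
apply/porbitP; exists m; rewrite -[i](permKV r) -conjXg permJ -jE.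
by rewrite permKV.
Qed.

(** Each point of the orbit is hit by a coset of the stabilizer. *)
Lemma sum_orbit (aT : finGroupType) (T : finType) (to : {action aT &-> T})
    (G : {group aT}) (x : T) (F : T -> nat) :
  (#|('C_G[x | to])%g| * (\sum_(y in orbit to G x) F y) = \sum_(a in G) F (to x a))%N.
Proof.
rewrite (partition_big (to x) (mem (orbit to G x))) /=; last first.
  by move=> a aG; apply: mem_orbit.
rewrite big_distrr /=; apply: eq_bigr => y /orbitP[a aG <-].
rewrite (eq_bigr (fun=> F (to x a))); last by move=> b /andP[_ /eqP->].
rewrite sum_nat_const; congr (_ * _)%N.
rewrite -(card_rcoset _ a) -(amove_act to x (finset.subsetT G) aG).
by apply: eq_card => b; rewrite !inE.
Qed.

(** A rotation is determined by its value at [0]. *)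
Lemma sum_rotations (p : nat) (F : 'S_p.+2 -> nat) :
  (\sum_(r in <[rho p.+2]>%g) F r = \sum_(i < p.+2) F (rho p.+2 ^+ i)%g)%N.
Proof.
rewrite (reindex_onto (fun i : 'I_p.+2 => rho p.+2 ^+ i)%g
  (fun r : 'S_p.+2 => r (0 : 'I_p.+2))) /=.
  apply: eq_bigl => i; rewrite mem_cycle rhoX add0r natr_Zp eqxx//.
move=> r /cycleP[m ->]; apply/permP => i.
by rewrite !rhoX add0r natr_Zp.
Qed.

(** Pascal's rule splits off a term [b i * 'C(M, p.+1)] with
    [M = p.+2 + k - d - 1], and [p.+2 * 'C(M, p.+2) = (k - d) * 'C(M, p.+1)]. *)
Lemma binomial_sum (p k d : nat) (b : 'I_p.+2 -> bool) :
  (d <= k)%N -> ((\sum_i b i).+1 = d)%N ->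
  (\sum_i 'C(p.+2 + k - d + b i - 1, p.+2)
    = (k - 1) * 'C(p.+2 + k - d - 1, p.+2 - 1))%N.
Proof.
move=> dk bd; set M := (p.+2 + k - d - 1)%N.
have binE i : 'C(p.+2 + k - d + b i - 1, p.+2) = ('C(M, p.+2) + b i * 'C(M, p.+1))%N.
  case: (b i); last by rewrite addn0 mul0n addn0.
  by rewrite (_ : _ + _ - 1 = M.+1)%N ?binS ?mul1n// /M; lia.
under eq_bigr do rewrite binE.
rewrite big_split /= sum_nat_const card_ord -big_distrl /= mul_bin_left -mulnDl.
rewrite subn1; congr (_ * _)%N; rewrite /M -bd; move: (\sum_i _)%N bd => B bd; lia.
Qed.

(** The copy of [t] rotated by [i] has at [ord_max] the signature entry of [t]
    at [ord_max - i]. *)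
Lemma sum_comb_type (p k : nat) (t : 'S_p.+2) :
  one_cycle t -> (des t <= k)%N ->
  (symord t * (\sum_(u in comb_type t) #|admissible k u|)
    = (k - 1) * 'C(p.+2 + k - des t - 1, p.+2 - 1))%N.
Proof.
move=> tc dk; rewrite sum_orbit sum_rotations.
rewrite -(@binomial_sum p k (des t) (fun i => lag t i < gap t i)%N)//; last first.
  by rewrite -sum_sig//; congr S; apply: eq_bigr => i _; rewrite nth_sig.
rewrite [RHS](reindex_inj (inv_inj (subKr (ord_max : 'I_p.+2)))).
apply: eq_bigr => i _; rewrite card_admissible// des_conj.
rewrite -(gap_conj i t) -(lag_conj i t) natr_Zp subrK.
by rewrite (nth_sig _ (ord_max : 'I_p.+2)).
Qed.

(** * The periodic points with given digits *)

(** If [j] is the image of [i] under [t ^+ m] and all powers of [t] kept the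
    order of the pair, then [i], [(t ^+ m) i], [(t ^+ (m * 2)) i], ... would increase for ever. *)
Lemma one_cycle_inversion (q : nat) (t : 'S_q) (i j : 'I_q) :
  one_cycle t -> ~ (forall m, ((t ^+ m)%g i < (t ^+ m)%g j)%N).
Proof.
move=> tc ijP; have [m jE] := one_cycle_reach i j tc.
(* The terms increase strictly with [c], so the one at [q] is too large. *)
have lec (c : nat) : (c <= (t ^+ (m * c))%g i)%N.
  elim: c => // c /leq_ltn_trans -> //; have := ijP (m * c)%N.
  by rewrite jE -permM -expgD mulnS.
by have := lec q; rewrite leqNgt ltn_ord.
Qed.

(** Constant admissible digits would force [t] to preserve the order. *)
Lemma admissible_neq (q k v : nat) (t : 'S_q) (n : {ffun 'I_q -> 'I_k}) :
  (2 <= q)%N -> one_cycle t -> n \in admissible k t -> exists j, n j != v :> nat.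
Proof.
move=> q2 tc /admissibleP nA.
case: (pickP (fun j => n j != v :> nat)) => [j jv|nv]; first by exists j.
exfalso; have q0 : (0 < q)%N by lia.
apply: (@one_cycle_inversion _ t (Ordinal q0) (Ordinal q2) tc).
elim=> [|m]; first by rewrite expg0 !perm1.
rewrite expgSr !permM.
move: ((t ^+ m)%g (Ordinal q0)) ((t ^+ m)%g (Ordinal q2)) => i j ij.
have := nA _ _ ij; move: (nv i) (nv j) => /negbFE/eqP-> /negbFE/eqP->.
have : t i != t j :> nat.
  by apply/eqP => /val_inj/perm_inj ijE; move: ij; rewrite ijE ltnn.
by case: ltngtP => //; lia.
Qed.

(** The geometric sum that solves [k x_i = x_(t i) + c_i] when [t ^+ q = 1]: the
    value of the periodic base-[k] expansion with digits [c (t^m i)]. *)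
Definition sol (R : realType) (k q : nat) (t : 'S_q) (c : 'I_q -> R) (i : 'I_q) : R :=
  (\sum_(m < q) k%:R ^+ (q - 1 - m) * c ((t ^+ m)%g i)) / (k%:R ^+ q - 1).

Lemma expn_sub1_gt0 (R : realType) (k q : nat) :
  (2 <= k)%N -> (0 < q)%N -> 0 < k%:R ^+ q - 1 :> R.
Proof. by move=> k2 q0; rewrite subr_gt0 exprn_egt1 ?ltr1n//; lia. Qed.

Lemma sol_eq (R : realType) (k q : nat) (t : 'S_q) (c : 'I_q -> R) (i : 'I_q) :
  (2 <= k)%N -> one_cycle t -> k%:R * sol k t c i = sol k t c (t i) + c i.
Proof.
move=> k2 tc; have q0 : (0 < q)%N by apply: leq_trans (ltn_ord i).
have D0 := expn_sub1_gt0 R k2 q0; move: (lt0r_neq0 D0) => {}D0.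
apply: (mulIf D0); rewrite mulrDl /sol mulrA !divfK// mulr_sumr.
case: q t i tc c q0 D0 => // p t i tc c _ D0.
rewrite big_ord_recl [in RHS]big_ord_recr/= expg0 perm1 subn0 !subn1/= subnn.
rewrite -permM -expgS one_cycle_expn// perm1 expr0 mul1r mulrA -exprS.
rewrite [X in _ = X + _ + _](_ : _ =
   \sum_(j < p) k%:R * (k%:R ^+ (p - bump 0 j) * c ((t ^+ bump 0 j)%g i))).
  by ring.
apply: eq_bigr => j _; rewrite mulrA -exprS -permM -expgS /bump /= add1n.
by rewrite subnSK.
Qed.

(** A difference [y] of two solutions satisfies [k ^+ q * y i = y i]. *)
Lemma sol_uniq (R : realType) (k q : nat) (t : 'S_q) (c x : 'I_q -> R) :
  (2 <= k)%N -> one_cycle t -> (forall i, k%:R * x i = x (t i) + c i) ->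
  x =1 sol k t c.
Proof.
move=> k2 tc xE i; have q0 : (0 < q)%N by apply: leq_trans (ltn_ord i).
pose y i := x i - sol k t c i.
have yE j : k%:R * y j = y (t j).
  by rewrite /y mulrBr xE sol_eq//; ring.
have yX m : k%:R ^+ m * y i = y ((t ^+ m)%g i).
  elim: m => [|m IH]; first by rewrite expr0 mul1r expg0 perm1.
  by rewrite exprS -mulrA IH yE expgSr permM.
have := yX q; rewrite one_cycle_expn// perm1 => /eqP.
rewrite -subr_eq0 -{2}[y i]mul1r -mulrBl mulf_eq0 gt_eqF ?expn_sub1_gt0//=.
by rewrite subr_eq0 => /eqP.
Qed.

Lemma sol_gt0 (R : realType) (k q : nat) (t : 'S_q) (c : 'I_q -> R) (i j : 'I_q) :
  (2 <= k)%N -> one_cycle t -> (forall l, 0 <= c l) -> 0 < c j ->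
  0 < sol k t c i.
Proof.
move=> k2 tc c0 cj; have q0 : (0 < q)%N by apply: leq_trans (ltn_ord i).
rewrite divr_gt0 ?expn_sub1_gt0//; have [m jE] := one_cycle_reach i j tc.
rewrite (bigD1 m)//= -jE ltr_pwDl ?mulr_gt0 ?exprn_gt0 ?ltr0n//; first by lia.
by apply: sumr_ge0 => l _; rewrite mulr_ge0 ?exprn_ge0.
Qed.

Definition point (R : realType) (k q : nat) (t : 'S_q) (n : {ffun 'I_q -> 'I_k}) :
  'I_q -> R := sol k t (fun i => (n i)%:R).

(** The numbers [1 - x_i] solve the system with the complementary digits
    [k - 1 - n_i], so both bounds are instances of [sol_gt0]. *)
Lemma point_bounds (R : realType) (k q : nat) (t : 'S_q) (n : {ffun 'I_q -> 'I_k}) i :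
  (2 <= k)%N -> (2 <= q)%N -> one_cycle t -> n \in admissible k t ->
  0 < point R t n i < 1.
Proof.
move=> k2 q2 tc nA.
(* The values [0] and [k.-1] give the strict bounds: digits that are all equal
   to one of them would put every point at [0] or at [1]. *)
have [j0 n0] := admissible_neq 0 q2 tc nA; have [j1 n1] := admissible_neq k.-1 q2 tc nA.
apply/andP; split.
  by apply: (@sol_gt0 _ _ _ _ _ _ j0) => //; rewrite ltr0n lt0n.
rewrite -subr_gt0.
rewrite (@sol_uniq R k q t (fun i => (k.-1 - n i)%N%:R) (fun i => 1 - point R t n i))//.
  apply: (@sol_gt0 _ _ _ _ _ _ j1) => //; rewrite ltr0n; have := ltn_ord (n j1).
  by move: n1; case: (nat_of_ord (n j1)) => //; lia.
move=> l; rewrite mulrBr sol_eq// natrB; last by have := ltn_ord (n l); lia.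
by rewrite -subn1 natrB ?(ltnW k2)// /point; ring.
Qed.

(** A pair with [i < j] but [x_j <= x_i] must have equal digits, since points
    differ by less than [1]; its image under [t] is then a pair of the same
    kind, and so for all powers of [t], against [one_cycle_inversion]. *)
Lemma point_lt (R : realType) (k q : nat) (t : 'S_q) (n : {ffun 'I_q -> 'I_k})
  (i j : 'I_q) :
  (2 <= k)%N -> (2 <= q)%N -> one_cycle t -> n \in admissible k t ->
  (i < j)%N -> point R t n i < point R t n j.
Proof.
move=> k2 q2 tc nA ij; rewrite ltNge; apply/negP => xij.
apply: (@one_cycle_inversion _ _ i j tc) => m.
suff /andP[] : ((t ^+ m)%g i < (t ^+ m)%g j)%N &&
  (point R t n ((t ^+ m)%g j) <= point R t n ((t ^+ m)%g i)) by [].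
elim: m => [|m]; first by rewrite expg0 !perm1 ij.
rewrite expgSr !permM.
move: ((t ^+ m)%g i) ((t ^+ m)%g j) => {}i {}j {ij xij} /andP[ij xij].
have /andP[ti0 ti1] := point_bounds R (t i) k2 q2 tc nA.
have /andP[tj0 tj1] := point_bounds R (t j) k2 q2 tc nA.
have := sol_eq (fun i => (n i)%:R : R) i k2 tc.
have := sol_eq (fun i => (n i)%:R : R) j k2 tc.
rewrite -!/(point R t n _) => jE iE.
have kij : k%:R * point R t n j <= k%:R * point R t n i by rewrite ler_wpM2l.
have nij : (n j < n i + 1)%N by rewrite -(ltr_nat R) natrD; lra.
have := admissibleP _ _ nA _ _ ij.
have : t i != t j :> nat.
  by apply/eqP => /val_inj/perm_inj ijE; move: ij; rewrite ijE ltnn.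
case: (ltngtP (t i) (t j)) => // _ _ nle; last by exfalso; move: nle nij => /=; lia.
have nE : (n i)%:R = (n j)%:R :> R by congr _%:R; lia.
by apply/andP; split => //; lra.
Qed.

(** * Realizations and admissible digits *)

Local Open Scope classical_set_scope.
Local Open Scope card_scope.

Definition coded (R : realType) (k q : nat) (t : 'S_q) (n : {ffun 'I_q -> 'I_k}) :
  set (circle R) := range (fun i => circle_pi (point R t n i)).

Arguments coded R {k q} t n.

Lemma circle_pi_inj (R : realType) (x y : R) :
  0 < x < 1 -> 0 < y < 1 -> circle_pi x = circle_pi y -> x = y.
Proof.
move=> /andP[x0 x1] /andP[y0 y1] /circle_piP/intrP[z zE].
have zl : (-1)%:~R < z%:~R :> R by rewrite -zE rmorphN /=; lra.
have zu : z%:~R < 1%:~R :> R by rewrite -zE /=; lra.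
move: zl zu; rewrite !ltr_int => zl zu; have z0 : z = 0 by lia.
by apply/eqP; rewrite -subr_eq0 zE z0.
Qed.

Lemma increasing_inj (R : realType) (q : nat) (x : 'I_q -> R) :
  (forall i j : 'I_q, (i < j)%N -> x i < x j) -> injective x.
Proof.
move=> xlt i j xij; apply: val_inj.
by case: (ltngtP i j) => // /xlt; rewrite xij ltxx.
Qed.

Lemma realizes_coded (R : realType) (k q : nat) (t : 'S_q)
    (n : {ffun 'I_q -> 'I_k}) :
  (2 <= k)%N -> (2 <= q)%N -> one_cycle t -> n \in admissible k t ->
  realizes k t (coded R t n).
Proof.
move=> k2 q2 tc nA.
have xb i := point_bounds R i k2 q2 tc nA.
have xlt i j := @point_lt R k q t n i j k2 q2 tc nA.
have xE i : mulcirc k (circle_pi (point R t n i)) = circle_pi (point R t n (t i)).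
  by rewrite mulcircE; apply/circle_piP; rewrite sol_eq// addrAC subrr add0r rpred_nat.
split; last by exists (point R t n).
have q0 : (0 < q)%N by lia.
pose i0 := Ordinal q0; pose p i := circle_pi (point R t n i).
have p_inj : injective p.
  by move=> i j /(circle_pi_inj (xb i) (xb j)); apply: increasing_inj.
have iterE m : iter m (mulcirc k) (p i0) = p ((t ^+ m)%g i0).
  by rewrite permX; elim: m => //= m ->; rewrite /p xE.
have trajE i m : traject (mulcirc k) (p i) m = map p (traject t i m).
  by elim: m i => //= m IH i; rewrite -IH /p xE.
exists (p i0); split.
- by rewrite iterE one_cycle_expn// perm1.
- by rewrite trajE map_inj_uniq// -[X in traject _ _ X](one_cycle_card i0 tc) uniq_traject_porbit.
rewrite trajE; apply/seteqP; split => [_ [i _ <-]|y] /=.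
  apply: map_f; rewrite -[X in traject _ _ X](one_cycle_card i0 tc).
  by rewrite -porbit_traject tc.
by case/mapP => i _ ->; exists i.
Qed.

(** The integer [k x_i - x_(t i)] lies strictly between [-1] and [k]. *)
Lemma coded_of_realizes (R : realType) (k q : nat) (t : 'S_q) (O : set (circle R)) :
  (2 <= k)%N -> one_cycle t -> realizes k t O ->
  exists2 n : {ffun 'I_q -> 'I_k}, n \in admissible k t & O = coded R t n.
Proof.
move=> k2 tc [_ [x [xb xlt -> xE]]].
have dig i : exists m : 'I_k, k%:R * x i = x (t i) + m%:R.
  have := xE i; rewrite mulcircE => /circle_piP/intrP[z zE].
  have /andP[x0 x1] := xb i; have /andP[y0 y1] := xb (t i).
  have kx0 : 0 < k%:R * x i by rewrite mulr_gt0// ltr0n; lia.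
  have kx1 : k%:R * x i < k%:R by rewrite gtr_pMr// ltr0n; lia.
  have zl : (-1)%:~R < z%:~R :> R by rewrite -zE rmorphN /=; lra.
  have zu : z%:~R < k%:~R :> R by rewrite -zE -pmulrn; lra.
  move: zl zu; rewrite !ltr_int => zl zu.
  have zk : (`|z| < k)%N by lia.
  exists (Ordinal zk) => /=; apply/eqP; rewrite addrC -subr_eq zE pmulrn.
  by apply/eqP; congr (_%:~R); lia.
pose n : {ffun 'I_q -> 'I_k} := [ffun i => projT1 (cid (dig i))].
have nE i : k%:R * x i = x (t i) + (n i)%:R by rewrite ffunE; case: cid.
exists n; last first.
  apply: eq_imagel => i _; congr circle_pi.
  by rewrite (@sol_uniq R k q t (fun i => (n i)%:R) x).
apply/admissibleP => i j ij; have := xlt _ _ ij; have := nE i; have := nE j.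
have /andP[a0 a1] := xb (t i); have /andP[b0 b1] := xb (t j).
move=> jE iE xij.
have kij : k%:R * x i < k%:R * x j by rewrite ltr_pM2l// ltr0n; lia.
case: ltnP => [/xlt tji|_]; first by rewrite /= addn1 -(ltr_nat R); lra.
by rewrite /= addn0 -ltnS -[X in (_ < X)%N]addn1 -(ltr_nat R) natrD; lra.
Qed.

Lemma increasing_range_uniq (R : realType) (q : nat) (x y : 'I_q -> R) :
  (forall i j : 'I_q, (i < j)%N -> x i < x j) ->
  (forall i j : 'I_q, (i < j)%N -> y i < y j) ->
  range x = range y -> x =1 y.
Proof.
move=> xlt ylt xy.
have srt (z : 'I_q -> R) : (forall i j : 'I_q, (i < j)%N -> z i < z j) ->
    sorted <%R (map z (enum 'I_q)).
  move=> zlt; rewrite sorted_map sorted_pairwise; last by move=> ? ? ?; apply: lt_trans.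
  exact/pairwise_enum_ordP.
have mem (z : 'I_q -> R) u : (u \in map z (enum 'I_q)) = `[< range z u >].
  apply/mapP/asboolP => [[i _ ->]|[i _ <-]]; first by exists i.
  by exists i => //; rewrite mem_enum.
have /eq_in_map xyE : map x (enum 'I_q) = map y (enum 'I_q).
  apply: (irr_sorted_eq lt_trans ltxx (srt _ xlt) (srt _ ylt)) => u.
  by rewrite !mem xy.
by move=> i; apply: xyE; rewrite mem_enum.
Qed.

(** An orbit determines its increasing enumeration in [(0, 1)], hence the
    permutation, hence the digits. *)
Lemma coded_inj (R : realType) (k q : nat) (t t' : 'S_q)
    (n n' : {ffun 'I_q -> 'I_k}) :
  (2 <= k)%N -> (2 <= q)%N -> one_cycle t -> one_cycle t' ->
  n \in admissible k t -> n' \in admissible k t' ->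
  coded R t n = coded R t' n' -> t = t' /\ n = n'.
Proof.
move=> k2 q2 tc tc' nA nA' cE.
have xb i := point_bounds R i k2 q2 tc nA.
have yb i := point_bounds R i k2 q2 tc' nA'.
have xlt i j := @point_lt R k q t n i j k2 q2 tc nA.
have ylt i j := @point_lt R k q t' n' i j k2 q2 tc' nA'.
have xyE : point R t n =1 point R t' n'.
  apply: increasing_range_uniq => //; apply/seteqP; split => _ [i _ <-].
    have : coded R t n (circle_pi (point R t n i)) by exists i.
    by rewrite cE => -[j _ /(circle_pi_inj (yb _) (xb _)) <-]; exists j.
  have : coded R t' n' (circle_pi (point R t' n' i)) by exists i.
  by rewrite -cE => -[j _ /(circle_pi_inj (xb _) (yb _)) <-]; exists j.
have xE i : k%:R * point R t n i = point R t n (t i) + (n i)%:R by apply: sol_eq.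
have yE i : k%:R * point R t n i = point R t' n' (t' i) + (n' i)%:R.
  by rewrite (xyE i); apply: sol_eq.
have tE i : t i = t' i.
  apply: (increasing_inj xlt); rewrite [RHS]xyE; apply: circle_pi_inj => //.
  apply/circle_piP; have -> : point R t n (t i) - point R t' n' (t' i) = (n' i)%:R - (n i)%:R.
    by have := xE i; have := yE i; lra.
  by rewrite rpredB ?rpred_nat.
have tt' : t = t' by apply/permP.
split=> //; apply/ffunP => i; apply/val_inj/eqP; rewrite -(eqr_nat R); apply/eqP.
by have := xE i; rewrite yE -tE -xyE => /addrI ->.
Qed.

(** Pairs of a permutation in [C] and admissible digits for it are in bijection
    with the orbits; [C] is a singleton or a combinatorial type below. *)
Lemma card_realizations (R : realType) (k q : nat) (C : {set 'S_q}) :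
  (2 <= k)%N -> (2 <= q)%N -> {in C, forall t, one_cycle t} ->
  [set O : set (circle R) | exists2 t, t \in C & realizes k t O]
    #= `I_(\sum_(t in C) #|admissible k t|)%N.
Proof.
move=> k2 q2 Cc.
pose S := [set p : 'S_q * {ffun 'I_q -> 'I_k} | (p.1 \in C) && (p.2 \in admissible k p.1)]%SET.
have memS p : (p \in S) = (p.1 \in C) && (p.2 \in admissible k p.1).
  by rewrite [LHS]inE.
have -> : (\sum_(t in C) #|admissible k t| = #|S|)%N.
  under eq_bigr do rewrite -sum1_card.
  by rewrite pair_big_dep -sum1_card /=; apply: eq_bigl => p; rewrite memS.
have SE : [set` S] #= `I_#|S|.
  apply/card_set_bijP; exists (fun p => index p (enum S)); split.
  - by move=> p /= pS; rewrite cardE index_mem mem_enum.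
  - move=> p p' /set_mem pS /set_mem p'S /(congr1 (nth p (enum S))).
    by rewrite !nth_index ?mem_enum.
  move=> m /= mS; have [p0 _] : exists p, p \in S by apply/card_gt0P; apply: leq_trans mS.
  exists (nth p0 (enum S) m); first by rewrite /= -mem_enum mem_nth// -cardE.
  by rewrite index_uniq ?enum_uniq// -cardE.
apply: card_eq_trans SE.
rewrite (_ : [set O | _] = (fun p => coded R p.1 p.2) @` [set` S]).
  apply: inj_card_eq => -[t n] [t' n'] /set_mem/=; rewrite memS => /andP[/= tC nA].
  move=> /set_mem/=; rewrite memS => /andP[/= tC' nA'].
  by move=> /(coded_inj k2 q2 (Cc _ tC) (Cc _ tC') nA nA')[-> ->].
apply/seteqP; split => [O [t tC rO]|_ [[t n] /= tnS <-]] /=.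
  have [n nA ->] := coded_of_realizes k2 (Cc _ tC) rO.
  by exists (t, n) => //=; rewrite memS /= tC.
move: tnS; rewrite memS => /andP[/= tC nA].
by exists t => //; apply: realizes_coded => //; apply: Cc.
Qed.

Local Close Scope ring_scope.

(** * The numbers of realizations *)

Theorem mainTheorem2 (R : realType) (q : nat) (hq : (2 <= q)%N)
    (sigma : 'S_q) (hsigma : is_qcycle sigma)
    (d s : nat) (a : q.-tuple nat)
    (hd : des sigma = d) (hs : symord sigma = s) (ha : sig sigma = a)
    (k : nat) (hk : (maxn d 2 <= k)%N) :
  [set O : set (circle R) | realizes k sigma O]
    #= `I_('C(q + k - d + nth 0 a q.-1 - 1, q))%N
  /\
  exists N : nat,
    [set O : set (circle R) | realizes_type k sigma O] #= `I_N /\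
    (N%:R = (k - 1)%N%:R / s%:R * ('C(q + k - d - 1, q - 1)%N)%:R :> rat)%R.
Proof.
have sc := qcycle_one_cycle hsigma; move: hk; rewrite geq_max => /andP[dk k2].
split.
  have := @card_realizations R k q [set sigma]%SET k2 hq.
  rewrite big_set1 card_admissible// hd ha.
  rewrite (_ : [set O | exists2 t, _ & _] = [set O | realizes k sigma O]).
    by apply => t /set1P ->.
  apply/seteqP; split => O /=; first by case=> t /set1P ->.
  by exists sigma; rewrite ?set11.
exists (\sum_(t in comb_type sigma) #|admissible k t|)%N; split.
  by apply: card_realizations => // t /orbitP[r _ <-]; apply: one_cycle_conj.
have s0 : (0 < s)%N by rewrite -hs cardG_gt0.
have sr0 : (s%:R != 0 :> rat)%R by rewrite pnatr_eq0 -lt0n.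
case: q hq sigma hsigma a hd hs ha sc => [|[|p]]// _ sigma _ a hd hs _ sc.
apply: (mulfI sr0); rewrite -natrM -{1}hs sum_comb_type ?hd//.
by rewrite natrM mulrA mulrCA divff// mulr1.
Qed.
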